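(* Let $l>0$, $\mu>0$ and $p\ge\mu$. For the Fly-and-Die dynamics with parameters $l,\mu$, the velocity moments satisfy $$\langle v^p(t)\rangle\sim l\,t^{-\mu}\qquad\text{as }t\to\infty.$$
   Context: Fly-and-Die dynamics with parameters $l>0$, $\mu>0$: for $x_0\in(0,1]$ let $t_c(x_0)=(l/x_0)^{1/\mu}$. The trajectory starting at $x_0$ is $x(x_0,t)=x_0+t$ for $0\le t\le t_c(x_0)$ and $x(x_0,t)=x_0+t_c(x_0)$ for $t\ge t_c(x_0)$. Its velocity is $v(x_0,t)=1$ while flying ($t<t_c(x_0)$) and $v(x_0,t)=0$ once stopped ($t>t_c(x_0)$). The initial condition $x_0$ is uniformly distributed in $[0,1]$, and $\langle v^p(t)\rangle=\int_0^1 v(x_0,t)^p\,dx_0$. The symbol $A\sim B$ means $A/B\to1$. *)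

(* Defs.v *)
From HB Require Import structures.
From mathcomp Require Import all_boot all_order all_algebra.
From mathcomp Require Import all_classical all_reals all_analysis.

Set Implicit Arguments.
Unset Strict Implicit.
Unset Printing Implicit Defensive.

Import Order.TTheory GRing.Theory Num.Theory.
Import numFieldNormedType.Exports.

Local Open Scope classical_set_scope.
Local Open Scope ring_scope.

Section FlyAndDie.
Context {R : realType}.
Implicit Types (l mu p t : R) (v : R -> R -> R).

Definition fad_stop_time l mu (x0 : R) : R := (l / x0) `^ mu^-1.

Definition fad_position l mu (x0 : R) t : R :=
  x0 + Num.min t (fad_stop_time l mu x0).

(* The velocity jumps from 1 to 0 at the stopping time, where the dynamics does
   not assign it a value: [v x0 t] is arbitrary at [t = fad_stop_time l mu x0]
   (and for [x0] outside ]0, 1] or [t < 0]). *)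
Definition fad_velocity l mu v : Prop :=
  forall x0 t, 0 < x0 <= 1 -> 0 <= t ->
    (t < fad_stop_time l mu x0 -> v x0 t = 1) /\
    (fad_stop_time l mu x0 < t -> v x0 t = 0).

(* The stopping time is undefined at [x0 = 0], hence the half-open interval.
   The real power [powR] satisfies [0 `^ p = 0] for [p != 0]. *)
Definition velocity_moment v p t : R :=
  \int[lebesgue_measure]_(x0 in `]0, 1]) (v x0 t `^ p).

(* Away from the stopping time, a Fly-and-Die velocity is the time derivative
   of the trajectory. *)
Lemma fad_velocity_is_derive l mu v (x0 : R) t :
  fad_velocity l mu v -> 0 < x0 <= 1 -> 0 <= t ->
  t != fad_stop_time l mu x0 ->
  is_derive t (1 : R) (fad_position l mu x0) (v x0 t).
Proof.
move=> hv hx ht; have [v1 v0] := hv _ _ hx ht.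
rewrite neq_lt => /orP[tlt|tgt].
- rewrite (v1 tlt); apply: (@near_eq_is_derive _ _ _ (fun s => x0 + s)).
  + near=> s; rewrite /fad_position minEle ifT//.
    by apply: ltW; near: s; exact: lt_nbhsl.
  + by rewrite -[X in is_derive _ _ _ X]add0r; apply: is_deriveD.
- rewrite (v0 tgt).
  apply: (@near_eq_is_derive _ _ _ (cst (x0 + fad_stop_time l mu x0))).
  + near=> s; rewrite /fad_position /= minEle ifF//.
    by apply/negbTE; rewrite -ltNge; near: s; exact: lt_nbhsr.
Unshelve. all: by end_near. Qed.

End FlyAndDie.

(* Main.v *)
(** A trajectory is still flying at time [t] exactly when [x0 < c] with
    [c = l * t `^ (- mu)], up to the single point [x0 = c]. As soon as [c <= 1],
    the moment is therefore the measure of [`]0, c[], so that the claimed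
    asymptotic equivalence is an equality for all large [t]. *)
Require Import Defs.
From HB Require Import structures.
From mathcomp Require Import all_boot all_order all_algebra.
From mathcomp Require Import all_classical all_reals all_analysis.
From mathcomp Require Import measurable_realfun.

Import Order.TTheory GRing.Theory Num.Theory.
Import numFieldNormedType.Exports.

Local Open Scope classical_set_scope.
Local Open Scope ring_scope.

Lemma powRK {R : realType} {a x : R} : a != 0 -> 0 <= x ->
  (x `^ a) `^ a^-1 = x.
Proof. by move=> a0 x0; rewrite -powRrM mulfV// powRr1. Qed.

Lemma lt_fad_stop_time {R : realType} {l mu x t : R} :
  0 < l -> 0 < mu -> 0 < x -> 0 < t -> x < l * t `^ (- mu) ->
  t < fad_stop_time l mu x.
Proof.
move=> l0 mu0 x0 t0; rewrite powRN ltr_pdivlMr ?powR_gt0// => h.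
have -> : t = (t `^ mu) `^ mu^-1 by rewrite powRK ?gt_eqF// ltW.
apply: gt0_ltr_powR; rewrite ?invr_gt0// ?nnegrE ?powR_ge0//.
  by rewrite divr_ge0// ltW.
by rewrite ltr_pdivlMr// mulrC.
Qed.

Lemma fad_stop_time_lt {R : realType} {l mu x t : R} :
  0 < l -> 0 < mu -> 0 < x -> 0 < t -> l * t `^ (- mu) < x ->
  fad_stop_time l mu x < t.
Proof.
move=> l0 mu0 x0 t0; rewrite powRN ltr_pdivrMr ?powR_gt0// => h.
have -> : t = (t `^ mu) `^ mu^-1 by rewrite powRK ?gt_eqF// ltW.
apply: gt0_ltr_powR; rewrite ?invr_gt0// ?nnegrE ?powR_ge0//.
  by rewrite divr_ge0// ltW.
by rewrite ltr_pdivrMr// mulrC.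
Qed.

Lemma velocity_momentE {R : realType} {l mu p t : R} {v : R -> R -> R} :
  0 < l -> 0 < mu -> p != 0 -> fad_velocity l mu v ->
  0 < t -> l * t `^ (- mu) <= 1 ->
  velocity_moment v p t = l * t `^ (- mu).
Proof.
move=> l0 mu0 p0 hv t0; set c := l * _ => c1.
have c0 : 0 < c by rewrite mulr_gt0// powR_gt0.
(* The trajectory from [c] stops exactly at time [t], where [v c t] is arbitrary; its power is
   carried along as a weight on the null set [[set c]]. *)
set k := v c t `^ p.
have k0 : 0 <= k by exact: powR_ge0.
rewrite /velocity_moment.
under eq_Rintegral.
  move=> x; rewrite inE/= in_itv/= => x01.
  have [x0 _] := andP x01.
  have [v1 v0] := hv x t x01 (ltW t0).
  have -> : v x t `^ p = \1_(`]0, c[) x + k * \1_[set c] x.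
    have [xc|cx|->] := ltgtP x c.
    - rewrite (v1 (lt_fad_stop_time l0 mu0 x0 t0 xc)) powR1.
      rewrite !indicE mem_set/= ?in_itv/= ?x0// memNset ?mulr0 ?addr0//=.
      by apply/eqP; rewrite lt_eqF.
    - rewrite (v0 (fad_stop_time_lt l0 mu0 x0 t0 cx)) powR0//.
      rewrite !indicE !memNset/= ?mulr0 ?addr0//.
        by apply/eqP; rewrite gt_eqF.
      by rewrite in_itv/= x0/= ltNge ltW.
    - rewrite !indicE memNset/= ?in_itv/= ?ltxx ?andbF//.
      by rewrite mem_set//= mulr1 add0r.
  over.
rewrite /Rintegral.
under eq_integral do rewrite EFinD EFinM.
rewrite ge0_integralD//=; last first.
- by apply/measurable_EFinP; apply: measurable_funM.
- by move=> x _; rewrite -EFinM lee_fin mulr_ge0.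
- exact/measurable_EFinP.
rewrite ge0_integralZl_EFin//; last exact/measurable_EFinP.
rewrite !integral_indic//.
(* Both []0, c[] and [[set c]] lie inside the integration domain, thanks to [0 < c <= 1]. *)
rewrite !setIidl.
- rewrite [X in (_ * X)%E]lebesgue_measure_set1 mule0 adde0.
  rewrite [X in fine X]lebesgue_measure_itv/=.
  by rewrite lte_fin c0 oppr0 adde0.
- by move=> _ ->; rewrite /= in_itv/= c0.
- move=> x /=; rewrite !in_itv/= => /andP[-> xc].
  exact/ltW/(lt_le_trans xc).
Qed.

Theorem mainTheorem9 (R : realType) (l mu p : R) (v : R -> R -> R)
  (hl : 0 < l) (hmu : 0 < mu) (hp : mu <= p) (hv : fad_velocity l mu v) :
  velocity_moment v p t / (l * t `^ (- mu)) @[t --> +oo%R] --> (1 : R).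
Proof.
have p0 : p != 0 by rewrite gt_eqF// (lt_le_trans hmu).
apply: cvg_near_cst; near=> t.
have t0 : 0 < t by near: t; exact: nbhs_pinfty_gt.
rewrite (velocity_momentE hl hmu p0 hv t0)//.
  by rewrite divff// gt_eqF// mulr_gt0// powR_gt0.
(* The condition [c <= 1] becomes [l <= t]^ mu[, which holds once]t[exceeds the threshold]l
   [^ mu^-1]. *)
rewrite powRN ler_pdivrMr ?powR_gt0// mul1r.
have -> : l = (l `^ mu^-1) `^ mu by rewrite -{2}(invrK mu) powRK ?invr_neq0 ?gt_eqF// ltW.
apply: ge0_ler_powR; rewrite ?nnegrE ?powR_ge0// ltW//.
Unshelve. all: by end_near. Qed.
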